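(* Let the TDCD algorithm (defined in the context) be run with $N$ silos, $K_j\ge1$ clients in silo $j$, $Q\ge1$ local iterations per communication round, and $R$ communication rounds, from a deterministic initial model $\tilde{\boldsymbol\theta}^0$, and suppose Assumptions A1, A2, A3 stated in the context hold. If the learning rate satisfies $\eta\propto\frac{1}{Q\sqrt R}$, i.e. $\eta=\frac{c}{Q\sqrt R}$ for a constant $c>0$ independent of $R$, then the average expected squared gradient norm converges at rate $\mathcal{O}(1/\sqrt R)$ in the number $R$ of communication rounds: there exist constants $C$ and $R_0$, independent of $R$, such that for all $R\ge R_0$, $$\frac1R\sum_{r=0}^{R-1}\mathbb{E}\left[\|\nabla\mathcal{L}(\tilde{\boldsymbol\theta}^{rQ})\|^2\right]\le\frac{C}{\sqrt R}.$$
   Context: **Data and loss.** There are $M$ samples. Sample $p$ has label $y^{(p)}$ and features split into $N$ vertical blocks $\mathbf{X}^{(p)}_1,\dots,\mathbf{X}^{(p)}_N$, block $j$ belonging to silo $j$. Silo $j$ has $K_j$ clients, and the $M$ sample IDs are partitioned among the clients of silo $j$ (the partition may differ from silo to silo). The model is $\boldsymbol\theta=[\boldsymbol\theta_1^\intercal,\dots,\boldsymbol\theta_N^\intercal]^\intercal\in\mathbb{R}^D$, with coordinate block $\boldsymbol\theta_j$ belonging to silo $j$. With differentiable embedding maps $h_j$ (values in a common Euclidean space) and a differentiable per-sample loss $\ell$, the (possibly non-convex) objective is $$\mathcal{L}(\boldsymbol\theta)=\frac1M\sum_{p=1}^M\ell\Big(\sum_{j=1}^Nh_j(\boldsymbol\theta_j;\mathbf{X}^{(p)}_j);\,y^{(p)}\Big).$$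 $\nabla_{(j)}\mathcal{L}$ denotes the partial gradient with respect to block $j$. **Stochastic partial derivatives.** For a mini-batch (set of sample IDs) $\zeta$, let $\zeta_{k,j}$ be the subset of $\zeta$ held by client $k$ of silo $j$, and let $$g_{k,j}(\boldsymbol\theta;\zeta)=\frac{1}{|\zeta_{k,j}|}\sum_{p\in\zeta_{k,j}}\nabla_{\boldsymbol\theta_j}\,\ell\Big(\sum_{l=1}^Nh_l(\boldsymbol\theta_l;\mathbf{X}^{(p)}_l);\,y^{(p)}\Big)$$ (interpreted as $0$ if $\zeta_{k,j}=\emptyset$). **TDCD algorithm.** Start from $\tilde{\boldsymbol\theta}^0$. Communication takes place at iterations $t_0\in\{0,Q,2Q,\dots\}$. At each such $t_0$, a mini-batch $\zeta^{t_0}$ (the same for all silos and clients) is drawn uniformly at random from all samples, independently of the past, and every client $k$ of every silo $j$ sets $\boldsymbol\theta_{k,j}^{t_0}=\tilde{\boldsymbol\theta}_j^{t_0}$. For $t=t_0,\dots,t_0+Q-1$ all clients in parallel perform $$\boldsymbol\theta_{k,j}^{t+1}=\boldsymbol\theta_{k,j}^t-\eta\,g_{k,j}(\mathbf{y}_{k,j}^t;\zeta^{t_0}),$$ where $\mathbf{y}_{k,j}^t\in\mathbb{R}^D$ is the vector whose block $j$ is $\boldsymbol\theta_{k,j}^t$ and whose block $l\ne j$ is $\tilde{\boldsymbol\theta}_l^{t_0}$ (stale information; the same mini-batch is reused for the $Q$ iterations). For every $t$, the global model is $\tilde{\boldsymbol\theta}^t$ with blocks $\tilde{\boldsymbol\theta}_j^t=\frac{1}{K_j}\sum_{k=1}^{K_j}\boldsymbol\theta_{k,j}^t$;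 in particular, at $t=t_0+Q$ the hub of silo $j$ holds this average, which starts the next round. $\mathbb{E}$ is the expectation over all mini-batch draws. **Assumptions.** For all $\boldsymbol\theta,\boldsymbol\theta_1,\boldsymbol\theta_2\in\mathbb{R}^D$ and all $j,k$ (with Lipschitz constants $L,L_{k,j}>0$): (A1) $\|\nabla\mathcal{L}(\boldsymbol\theta_1)-\nabla\mathcal{L}(\boldsymbol\theta_2)\|\le L\|\boldsymbol\theta_1-\boldsymbol\theta_2\|$, and $\|g_{k,j}(\boldsymbol\theta_1;\zeta)-g_{k,j}(\boldsymbol\theta_2;\zeta)\|\le L_{k,j}\|\boldsymbol\theta_1-\boldsymbol\theta_2\|$ for every mini-batch $\zeta$. (A2) $\mathcal{L}(\boldsymbol\theta)\ge\mathcal{L}_{inf}$ for some real constant $\mathcal{L}_{inf}$. (A3) For a random mini-batch $\zeta$ drawn as in the algorithm, $\mathbb{E}_\zeta[g_{k,j}(\boldsymbol\theta;\zeta)]=\nabla_{(j)}\mathcal{L}(\boldsymbol\theta)$ and $\mathbb{E}_\zeta\|g_{k,j}(\boldsymbol\theta;\zeta)-\nabla_{(j)}\mathcal{L}(\boldsymbol\theta)\|^2\le\sigma_j^2$. *)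

(* Defs.v *)
From HB Require Import structures.
From mathcomp Require Import all_boot all_order all_algebra.
From mathcomp Require Import all_classical all_reals all_analysis.

Set Implicit Arguments.
Unset Strict Implicit.
Unset Printing Implicit Defensive.

Import Order.TTheory GRing.Theory Num.Theory.
Import numFieldNormedType.Exports.

Local Open Scope classical_set_scope.
Local Open Scope ring_scope.

(* The norm `|v| of 'rV[R]_n in MathComp-Analysis is the sup norm. *)
Definition enorm (R : realType) (n : nat) (v : 'rV[R]_n) : R :=
  Num.sqrt (\sum_i v 0 i ^+ 2).

Definition gradient (R : realType) (n : nat) (f : 'rV[R]_n -> R)
    (x : 'rV[R]_n) : 'rV[R]_n :=
  \row_i 'D_(delta_mx 0 i) f x.

(* Block j of the feature vector of sample p is [feat j p], an element of an
   arbitrary type. [owner j p] is the client of silo j that holds the sample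
   ID p, so that the fibres of [owner j] are the partition of the sample IDs
   among the clients of silo j. *)
Record tdcd_data (R : realType) := TDCDData {
  nsilos : nat;
  nsamples : nat;
  nclients : 'I_nsilos -> nat;
  bdim : 'I_nsilos -> nat;
  edim : nat;
  feature : 'I_nsilos -> Type;
  label : Type;
  feat : forall j, 'I_nsamples -> feature j;
  lab : 'I_nsamples -> label;
  owner : forall j, 'I_nsamples -> 'I_(nclients j);
  embed : forall j, 'rV[R]_(bdim j) -> feature j -> 'rV[R]_edim;
  ell : 'rV[R]_edim -> label -> R
}.

Arguments nclients {R} _ _.
Arguments bdim {R} _ _.
Arguments feature {R} _ _.
Arguments feat {R} _ _ _.
Arguments lab {R} _ _.
Arguments owner {R} _ _ _.
Arguments embed {R} _ _ _ _.
Arguments ell {R} _ _ _.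

Definition model (R : realType) (V : tdcd_data R) : Type :=
  'rV[R]_(\sum_j bdim V j).

Definition sample_loss (R : realType) (V : tdcd_data R) (p : 'I_(nsamples V))
    (theta : model V) : R :=
  ell V (\sum_j embed V j (submxrow theta j) (feat V j p)) (lab V p).

Definition loss (R : realType) (V : tdcd_data R) (theta : model V) : R :=
  (nsamples V)%:R^-1 * \sum_p sample_loss p theta.

Arguments loss {R} V theta.

Definition partial_gradient (R : realType) (V : tdcd_data R)
    (j : 'I_(nsilos V)) (f : model V -> R) (theta : model V) :
    'rV[R]_(bdim V j) :=
  submxrow (gradient f theta) j.

(* This is 0 when client k of silo j holds no sample of the mini-batch. *)
Definition stoch_gradient (R : realType) (V : tdcd_data R)
    (j : 'I_(nsilos V)) (k : 'I_(nclients V j)) (theta : model V)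
    (zeta : {set 'I_(nsamples V)}) : 'rV[R]_(bdim V j) :=
  let zeta_kj := [set p in zeta | owner V j p == k]%SET in
  #|zeta_kj|%:R^-1 *:
    \sum_(p in zeta_kj) partial_gradient j (sample_loss p) theta.

Definition client_models (R : realType) (V : tdcd_data R) : Type :=
  forall j : 'I_(nsilos V), 'I_(nclients V j) -> 'rV[R]_(bdim V j).

Definition silo_average (R : realType) (V : tdcd_data R)
    (th : client_models V) : model V :=
  \mxrow_j ((nclients V j)%:R^-1 *: \sum_k th j k).

Definition broadcast (R : realType) (V : tdcd_data R) (theta : model V) :
    client_models V :=
  fun j _ => submxrow theta j.

(* The model whose block j is x and whose other blocks are those of theta. *)
Definition with_block (R : realType) (V : tdcd_data R) (theta : model V)
    (j : 'I_(nsilos V)) (x : 'rV[R]_(bdim V j)) : model V :=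
  \mxrow_l dfwith (submxrow theta) j x l.

(* State at iteration t, after the communication if Q divides t: the global
   model of the last communication iteration t0 = Q * (t %/ Q), and the client
   models. The mini-batch drawn at t0 is [zeta (t %/ Q)]. *)
Fixpoint tdcd_state (R : realType) (V : tdcd_data R) (Q : nat) (eta : R)
    (theta0 : model V) (zeta : nat -> {set 'I_(nsamples V)}) (t : nat) :
    model V * client_models V :=
  match t with
  | 0%N => (theta0, broadcast theta0)
  | t'.+1 =>
    let: (stale, th) := tdcd_state Q eta theta0 zeta t' in
    let th' : client_models V := fun j k =>
      th j k - eta *: stoch_gradient k (with_block stale (th j k))
                                       (zeta (t' %/ Q)%N) in
    if (Q %| t'.+1)%N then (silo_average th', broadcast (silo_average th'))
    else (stale, th')
  end.

Definition global_model (R : realType) (V : tdcd_data R) (Q : nat) (eta : R)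
    (theta0 : model V) (zeta : nat -> {set 'I_(nsamples V)}) (t : nat) :
    model V :=
  silo_average (tdcd_state Q eta theta0 zeta t).2.

(* Every subset of a finite type is an event, so no sigma-algebra on T is
   needed for random variables with values in T. *)
Definition finite_random_variable (d : measure_display)
    (Omega : measurableType d) (T : finType) (X : Omega -> T) : Prop :=
  forall A : set T, measurable (X @^-1` A).

Definition mutually_independent (d : measure_display)
    (Omega : measurableType d) (R : realType) (P : probability Omega R)
    (T : finType) (X : nat -> Omega -> T) : Prop :=
  forall (I : seq nat) (A : nat -> set T), uniq I ->
    P (\bigcap_(i in [set` I]) X i @^-1` A i) =
    (\prod_(i <- I) P (X i @^-1` A i))%E.

(* The law of X is uniform on the subsets of {0, ..., m - 1} of size b. *)
Definition uniform_batch (d : measure_display) (Omega : measurableType d)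
    (R : realType) (P : probability Omega R) (m b : nat)
    (X : Omega -> {set 'I_m}) : Prop :=
  forall S : {set 'I_m},
    P (X @^-1` [set S]) = (if #|S| == b then 'C(m, b)%:R^-1 else 0)%:E.

(* Main.v *)
Require Import Defs.
From HB Require Import structures.
From mathcomp Require Import all_boot all_order all_algebra.
From mathcomp Require Import all_classical all_reals all_analysis.
From mathcomp Require Import ring lra.

Set Implicit Arguments.
Unset Strict Implicit.
Unset Printing Implicit Defensive.

Import Order.TTheory GRing.Theory Num.Theory.
Import numFieldNormedType.Exports.

Local Open Scope classical_set_scope.
Local Open Scope ring_scope.

(** Write A = eta * Q. If 2 Lam A <= 1, the Q local steps of a client started at
    x move it by - A g + e, where g is its stochastic gradient at x and
    |e| <= 2 Lam A^2 |g|, since the iterates stay within 2 A |g| of x. Hence a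
    whole round is one stochastic gradient step of size A up to an error of
    order A^2, and the descent inequality for the L-smooth loss, averaged over
    the mini-batch of the round (independent of its starting point), gives
      E loss(x_{r+1}) <= E loss(x_r) - A E|grad(x_r)|^2
                         + A^2 B (E|grad(x_r)|^2 + sum_j sigma_j^2)
    with B = 3 Lam + 8 L. When A B <= 1/2 half of the negative term survives;
    telescoping and putting A = c / sqrt R yields the rate. All random variables
    are functions of finitely many mini-batches, so every expectation is a
    finite sum weighted by a probability mass function. *)

(** * Euclidean geometry of row vectors *)

Definition dotp (R : realType) (n : nat) (u v : 'rV[R]_n) : R :=
  \sum_i u 0 i * v 0 i.

Lemma dotpC (R : realType) n (u v : 'rV[R]_n) : dotp u v = dotp v u.
Proof. by apply: eq_bigr => i _; rewrite mulrC. Qed.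

Lemma dotpDl (R : realType) n (u v w : 'rV[R]_n) :
  dotp (u + v) w = dotp u w + dotp v w.
Proof. by rewrite -big_split; apply: eq_bigr => i _; rewrite mxE mulrDl. Qed.

Lemma dotpZl (R : realType) n (a : R) (u v : 'rV[R]_n) :
  dotp (a *: u) v = a * dotp u v.
Proof. by rewrite mulr_sumr; apply: eq_bigr => i _; rewrite mxE mulrA. Qed.

Lemma dotpNl (R : realType) n (u v : 'rV[R]_n) : dotp (- u) v = - dotp u v.
Proof. by rewrite -scaleN1r dotpZl mulN1r. Qed.

Lemma dot0p (R : realType) n (v : 'rV[R]_n) : dotp 0 v = 0.
Proof. by rewrite -(scale0r 0) dotpZl mul0r. Qed.

Lemma dotp_suml (R : realType) n (I : finType) (f : I -> 'rV[R]_n) v :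
  dotp (\sum_i f i) v = \sum_i dotp (f i) v.
Proof.
by elim/big_ind2: _ => [|x1 x2 y1 y2 <- <-|//]; rewrite ?dot0p ?dotpDl.
Qed.

Lemma dotpDr (R : realType) n (u v w : 'rV[R]_n) :
  dotp w (u + v) = dotp w u + dotp w v.
Proof. by rewrite !(dotpC w) dotpDl. Qed.

Lemma dotpZr (R : realType) n (a : R) (u v : 'rV[R]_n) :
  dotp u (a *: v) = a * dotp u v.
Proof. by rewrite !(dotpC u) dotpZl. Qed.

Lemma dotpNr (R : realType) n (u v : 'rV[R]_n) : dotp u (- v) = - dotp u v.
Proof. by rewrite !(dotpC u) dotpNl. Qed.

Lemma dotp_sumr (R : realType) n (I : finType) (f : I -> 'rV[R]_n) v :
  dotp v (\sum_i f i) = \sum_i dotp v (f i).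
Proof. by rewrite dotpC dotp_suml; apply: eq_bigr => i _; rewrite dotpC. Qed.

Lemma dotp_ge0 (R : realType) n (u : 'rV[R]_n) : 0 <= dotp u u.
Proof. by apply: sumr_ge0 => i _; rewrite -expr2 sqr_ge0. Qed.

Lemma dotp_submxrow (R : realType) m (p : 'I_m -> nat)
    (u v : 'rV[R]_(\sum_j p j)) :
  dotp u v = \sum_j dotp (submxrow u j) (submxrow v j).
Proof.
have dotpE n (x y : 'rV[R]_n) : dotp x y = (x *m y^T) 0 0.
  by rewrite mxE; apply: eq_bigr => i _; rewrite mxE.
rewrite dotpE -{1}(submxrowK u) -{1}(submxrowK v) tr_mxrow mul_mxrow_mxcol.
by rewrite summxE; apply: eq_bigr => j _; rewrite dotpE.
Qed.

Lemma enorm_ge0 (R : realType) n (u : 'rV[R]_n) : 0 <= enorm u.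
Proof. exact: sqrtr_ge0. Qed.

Lemma enorm_sqr (R : realType) n (u : 'rV[R]_n) : enorm u ^+ 2 = dotp u u.
Proof.
rewrite /enorm sqr_sqrtr; last by apply: sumr_ge0 => i _; rewrite sqr_ge0.
by apply: eq_bigr => i _; rewrite expr2.
Qed.

Lemma enorm0 (R : realType) n : enorm (0 : 'rV[R]_n) = 0.
Proof. by apply/eqP; rewrite -sqrf_eq0 enorm_sqr dot0p. Qed.

Lemma enorm_eq0 (R : realType) n (u : 'rV[R]_n) : enorm u = 0 -> u = 0.
Proof.
move=> u0; have /eqP := enorm_sqr u; rewrite u0 expr0n /= eq_sym.
rewrite psumr_eq0; last by move=> i _; rewrite -expr2 sqr_ge0.
move=> /allP h; apply/rowP => i; rewrite mxE.
by have := h i (mem_index_enum i); rewrite mulf_eq0 orbb => /eqP.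
Qed.

Lemma enormZ (R : realType) n (a : R) (u : 'rV[R]_n) :
  enorm (a *: u) = `|a| * enorm u.
Proof.
apply/eqP; rewrite -(@eqrXn2 _ 2) ?mulr_ge0 ?enorm_ge0//.
by rewrite enorm_sqr dotpZl dotpZr exprMn enorm_sqr real_normK ?num_real// mulrA.
Qed.

(** Cauchy-Schwarz: the squared norm of [enorm v *: u - enorm u *: v] is nonnegative and equals
    twice [enorm u * enorm v] times the gap between the two sides. *)
Lemma dotp_le_enorm (R : realType) n (u v : 'rV[R]_n) :
  dotp u v <= enorm u * enorm v.
Proof.
have [->|u0] := eqVneq u 0; first by rewrite dot0p enorm0 mul0r.
have [->|v0] := eqVneq v 0; first by rewrite dotpC dot0p enorm0 mulr0.
have up : 0 < enorm u.
  by rewrite lt_neqAle enorm_ge0 andbT eq_sym; apply: contra_neq u0 => /enorm_eq0.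
have vp : 0 < enorm v.
  by rewrite lt_neqAle enorm_ge0 andbT eq_sym; apply: contra_neq v0 => /enorm_eq0.
have := dotp_ge0 (enorm v *: u - enorm u *: v).
rewrite !dotpDl !dotpDr !dotpNl !dotpNr !dotpZl !dotpZr (dotpC v u) -!enorm_sqr.
set a := enorm u in up *; set b := enorm v in vp *; set s := dotp u v.
rewrite -subr_ge0 => h; rewrite -subr_ge0 -(pmulr_rge0 _ (mulr_gt0 up vp)); nra.
Qed.

Lemma ler_enormD (R : realType) n (u v : 'rV[R]_n) :
  enorm (u + v) <= enorm u + enorm v.
Proof.
rewrite -(@ler_pXn2r _ 2) ?nnegrE ?addr_ge0 ?enorm_ge0//.
rewrite enorm_sqr !dotpDl !dotpDr (dotpC v u) sqrrD -!enorm_sqr.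
by have := dotp_le_enorm u v; lra.
Qed.

Lemma enormN (R : realType) n (u : 'rV[R]_n) : enorm (- u) = enorm u.
Proof. by rewrite -scaleN1r enormZ normrN1 mul1r. Qed.

(** Jensen's inequality for the squared norm: the difference of the two sides is the empirical
    variance of [f] about its mean [mu]. *)
Lemma enorm_sqr_mean_le (R : realType) n m (f : 'I_m -> 'rV[R]_n) :
  (0 < m)%N ->
  enorm (m%:R^-1 *: \sum_k f k) ^+ 2 <= m%:R^-1 * \sum_k enorm (f k) ^+ 2.
Proof.
move=> m0; set mu := _ *: _; have mN0 : m%:R != 0 :> R by rewrite pnatr_eq0 -lt0n.
have mp : 0 < m%:R :> R by rewrite ltr0n.
have sumE : \sum_k f k = m%:R *: mu by rewrite scalerA divff// scale1r.
have: 0 <= \sum_k dotp (f k - mu) (f k - mu).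
  by apply: sumr_ge0 => k _; exact: dotp_ge0.
have -> : \sum_k dotp (f k - mu) (f k - mu) =
    \sum_k enorm (f k) ^+ 2 - m%:R * enorm mu ^+ 2.
  transitivity (\sum_k (enorm (f k) ^+ 2 - (dotp (f k) mu *+ 2 - enorm mu ^+ 2))).
    apply: eq_bigr => k _; rewrite dotpDl !dotpDr !dotpNr !dotpNl !enorm_sqr.
    by rewrite (dotpC mu); ring.
  rewrite !sumrB sumrMnl -dotp_suml sumE dotpZl sumr_const card_ord -enorm_sqr.
  by rewrite -[_ *+ m]mulr_natl; ring.
by rewrite subr_ge0 -ler_pdivlMl.
Qed.

(** * The descent inequality *)

(** [gradient] only collects derivatives along the basis vectors; differentiability makes the
    derivative linear in the direction and so recovers all the others. *)
Lemma derive_gradient (R : realType) n (f : 'rV[R]_n -> R) (x v : 'rV[R]_n) :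
  differentiable f x -> 'D_v f x = dotp (gradient f x) v.
Proof.
move=> df; rewrite deriveE// {1}(row_sum_delta v) linear_sum.
by apply: eq_bigr => i _; rewrite linearZ mxE deriveE//= mulrC.
Qed.

Lemma is_derive_line (R : realType) n (f : 'rV[R]_n -> R) (x v : 'rV[R]_n) t :
  differentiable f (x + t *: v) ->
  is_derive t 1 (fun s => f (x + s *: v)) (dotp (gradient f (x + t *: v)) v).
Proof.
move=> df; have lineE : (fun h : R => h^-1 *: (((fun s => f (x + s *: v)) \o
      shift t) (h *: 1) - f (x + t *: v))) =
    (fun h => h^-1 *: ((f \o shift (x + t *: v)) (h *: v) - f (x + t *: v))).
  apply/funext => h /=.
  by rewrite [h *: 1]mulr1 scalerDl (addrCA x) addrA.
apply: DeriveDef; rewrite /derivable /derive lineE; last exact: derive_gradient.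
exact: diff_derivable.
Qed.

(** The mean value theorem on the segment from [x] to [x + v], with the change of gradient bounded
    by Cauchy-Schwarz. This gives the constant [L] instead of the sharp [L / 2], which affects only
    the final constant. *)
Lemma smooth_descent (R : realType) n (f : 'rV[R]_n -> R) (L : R) :
  (forall x, differentiable f x) ->
  (forall x y, enorm (gradient f x - gradient f y) <= L * enorm (x - y)) ->
  forall x v, f (x + v) <= f x + dotp (gradient f x) v + L * enorm v ^+ 2.
Proof.
move=> df fL x v.
have dg t := @is_derive_line R n f x v t (df _).
have cg : {within `[0, 1], continuous (fun s : R => f (x + s *: v))}.
  by apply: derivable_within_continuous => t _; have /@ex_derive := dg t.
have [t] := MVT ltr01 (fun t _ => dg t) cg.
rewrite in_itv /= => /andP[t0 t1]; rewrite scale1r scale0r addr0 subr0 mulr1.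
have := dotp_le_enorm (gradient f (x + t *: v) - gradient f x) v.
rewrite dotpDl dotpNl => h1 h2.
have h3 := fL (x + t *: v) x; rewrite [X in enorm (X - x)]addrC addrK in h3.
rewrite enormZ (ger0_norm (ltW t0)) in h3.
have v0 := enorm_ge0 v.
(* The sign comes from the Lipschitz bound itself: its left side is a norm, and [t] is positive. *)
have Lv : 0 <= L * enorm v.
  have := le_trans (enorm_ge0 _) h3; rewrite mulrCA => h.
  by rewrite -(pmulr_rge0 _ t0).
have h4 : L * (t * enorm v) <= L * enorm v by rewrite mulrCA ler_piMl// ltW.
have h5 := ler_wpM2r v0 (le_trans h3 h4).
by rewrite expr2 mulrA; lra.
Qed.

Lemma differentiable_submxrow (R : realType) m (p : 'I_m -> nat) j
    (x : 'rV[R]_(\sum_i p i)) :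
  differentiable (fun u : 'rV[R]_(\sum_i p i) => submxrow u j) x.
Proof.
pose c i (u : 'rV[R]_(\sum_i p i)) : R := submxrow u j 0 i.
have -> : (fun u : 'rV[R]_(\sum_i p i) => submxrow u j) =
    \sum_i (fun u => c i u *: (delta_mx 0 i : 'rV[R]_(p j))).
  by apply/funext => u; rewrite fct_sumE {1}(row_sum_delta (submxrow u j)).
apply: differentiable_sum => i; apply: differentiableZl.
rewrite /c; under [X in differentiable X _]eq_fun do rewrite !mxE.
exact: differentiable_coord.
Qed.

Lemma differentiable_loss (R : realType) (V : tdcd_data R) :
  (forall j (x : feature V j) (u : 'rV[R]_(bdim V j)),
     differentiable (fun u : 'rV[R]_(bdim V j) => embed V j u x) u) ->
  (forall (y : label V) (z : 'rV[R]_(edim V)),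
     differentiable (fun u : 'rV[R]_(edim V) => ell V u y) z) ->
  forall theta, differentiable (loss V) theta.
Proof.
move=> de dl theta.
have -> : loss V = (nsamples V)%:R^-1 *: (\sum_p sample_loss p).
  by apply/funext => x; rewrite /loss fctE /= fct_sumE.
apply/differentiableZ/differentiable_sum => p.
pose h (t : model V) := \sum_j embed V j (submxrow t j) (feat V j p).
rewrite (_ : sample_loss p = (fun z => ell V z (lab V p)) \o h)//.
apply: differentiable_comp => //.
have -> : h = \sum_j (fun t : model V => embed V j (submxrow t j) (feat V j p)).
  by apply/funext => t; rewrite fct_sumE.
apply: differentiable_sum => j.
apply: (@differentiable_comp _ _ _ _ (fun u : model V => submxrow u j)
  (fun z => embed V j z (feat V j p))) => //.
exact: differentiable_submxrow.
Qed.

(** * One communication round *)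

(** A single round unrolled from [tdcd_state]: the start [x] serves as the stale model throughout.
    Communication is left out, so index [Q] gives the client models just before averaging. *)
Fixpoint local_models (R : realType) (V : tdcd_data R) (eta : R) (x : model V)
    (S : {set 'I_(nsamples V)}) (i : nat) : client_models V :=
  match i with
  | 0%N => broadcast x
  | i'.+1 => fun j k =>
      let th := local_models eta x S i' in
      th j k - eta *: stoch_gradient k (with_block x (th j k)) S
  end.

Arguments local_models {R V} eta x S i _ _.

Definition round_step (R : realType) (V : tdcd_data R) (Q : nat) (eta : R)
    (x : model V) (S : {set 'I_(nsamples V)}) : model V :=
  silo_average (local_models eta x S Q).

Fixpoint round_model (R : realType) (V : tdcd_data R) (Q : nat) (eta : R)
    (x0 : model V) (zeta : nat -> {set 'I_(nsamples V)}) (r : nat) : model V :=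
  match r with
  | 0%N => x0
  | r'.+1 => round_step Q eta (round_model Q eta x0 zeta r') (zeta r')
  end.

(** Reduces the iteration-indexed algorithm to a recursion over rounds. The bound on [i] is strict
    because at offset [Q] the state has already been averaged and belongs to the next round. *)
Lemma tdcd_state_round (R : realType) (V : tdcd_data R) (Q : nat) (eta : R)
    (x0 : model V) (zeta : nat -> {set 'I_(nsamples V)}) (r i : nat) :
  (i < Q)%N ->
  tdcd_state Q eta x0 zeta (r * Q + i)%N =
  (round_model Q eta x0 zeta r,
   local_models eta (round_model Q eta x0 zeta r) (zeta r) i).
Proof.
move=> iQ; have Q0 : (0 < Q)%N by exact: leq_ltn_trans iQ.
elim: r i iQ => [|r IHr] i iQ; elim: i iQ => [|i IHi] iQ //.
- rewrite addnS /= IHi ?(ltnW iQ)//= mul0n add0n divn_small ?(ltnW iQ)//.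
  by rewrite gtnNdvd.
(* The start of a round is the outcome of the last local step of the previous one, whose index is a
   multiple of [Q], so the averaging branch is taken. *)
- have -> : (r.+1 * Q + 0 = (r * Q + Q.-1).+1)%N.
    by rewrite addn0 mulSn addnC -addnS prednK.
  rewrite /= IHr ?prednK// divnMDl// divn_small ?prednK// addn0.
  rewrite -addnS prednK// addnC -mulSn dvdn_mull//.
  have E : local_models eta (round_model Q eta x0 zeta r) (zeta r) Q =
    local_models eta (round_model Q eta x0 zeta r) (zeta r) Q.-1.+1.
    by rewrite prednK.
  by rewrite /round_step E.
- rewrite addnS [LHS]/= IHi ?(ltnW iQ)// divnMDl// divn_small ?(ltnW iQ)//.
  by rewrite addn0 -addnS dvdn_addr ?dvdn_mull// gtnNdvd.
Qed.

Lemma silo_average_broadcast (R : realType) (V : tdcd_data R) (x : model V) :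
  (forall j, (0 < nclients V j)%N) -> silo_average (broadcast x) = x.
Proof.
move=> K0; rewrite -[RHS](submxrowK x); apply: eq_mxrow => j.
rewrite sumr_const card_ord -[X in _ *: X]scaler_nat scalerA mulVf ?scale1r//.
by rewrite pnatr_eq0 -lt0n.
Qed.

Lemma global_model_round (R : realType) (V : tdcd_data R) (Q : nat) (eta : R)
    (x0 : model V) (zeta : nat -> {set 'I_(nsamples V)}) (r : nat) :
  (forall j, (0 < nclients V j)%N) -> (0 < Q)%N ->
  global_model Q eta x0 zeta (r * Q) = round_model Q eta x0 zeta r.
Proof.
move=> K0 Q0; rewrite /global_model -[(r * Q)%N]addn0 tdcd_state_round//.
exact: silo_average_broadcast.
Qed.

(** The start of round [r] depends only on batches drawn strictly earlier, hence is independent of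
    the batch of round [r]. *)
Lemma eq_round_model (R : realType) (V : tdcd_data R) (Q : nat) (eta : R)
    (x0 : model V) (z z' : nat -> {set 'I_(nsamples V)}) (r : nat) :
  (forall i, (i < r)%N -> z i = z' i) ->
  round_model Q eta x0 z r = round_model Q eta x0 z' r.
Proof.
elim: r => //= r IHr zz'; rewrite zz'// IHr// => i ir.
by rewrite zz'// ltnS ltnW.
Qed.

Lemma enorm_with_block (R : realType) (V : tdcd_data R) (x : model V) j
    (u : 'rV[R]_(bdim V j)) :
  enorm (with_block x u - x) = enorm (u - submxrow x j).
Proof.
apply/eqP; rewrite -(@eqrXn2 _ 2) ?enorm_ge0// !enorm_sqr dotp_submxrow.
rewrite [X in X == _](bigD1 j)//= [X in _ + X]big1 => [|l lj].
  by rewrite addr0 submxrowB mxrowK dfwithin.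
by rewrite submxrowB mxrowK dfwithout 1?eq_sym// subrr dot0p.
Qed.

(** Both bounds go through one induction: the distance bound at [i], fed into the Lipschitz
    condition, controls the new error at [i.+1], and the error bound at [i.+1] gives back the
    distance bound there. *)
Lemma local_models_drift (R : realType) (V : tdcd_data R) (Q : nat)
    (eta Lam : R) (x : model V) (S : {set 'I_(nsamples V)}) j
    (k : 'I_(nclients V j)) :
  0 <= eta -> 0 <= Lam -> 2 * Lam * (eta * Q%:R) <= 1 ->
  (forall y, enorm (stoch_gradient k y S - stoch_gradient k x S)
     <= Lam * enorm (y - x)) ->
  let g := stoch_gradient k x S in
  forall i, (i <= Q)%N ->
  enorm (local_models eta x S i j k - submxrow x j + (eta * i%:R) *: g)
    <= 2 * Lam * (eta * i%:R) * (eta * Q%:R) * enorm g /\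
  enorm (local_models eta x S i j k - submxrow x j)
    <= 2 * (eta * i%:R) * enorm g.
Proof.
move=> eta0 Lam0 etaQ gL g; elim=> [|i IHi] iQ.
  by rewrite /= subrr mulr0 scale0r addr0 enorm0 !(mulr0, mul0r).
(* By [2 * Lam * (eta * Q%:R) <= 1] the error is at most the length of the gradient part
   [(eta * i.+1%:R) *: g]; the triangle inequality then gives the factor 2 of the distance bound. *)
suff main : enorm (local_models eta x S i.+1 j k - submxrow x j +
      (eta * i.+1%:R) *: g)
    <= 2 * Lam * (eta * i.+1%:R) * (eta * Q%:R) * enorm g.
  split=> //.
  rewrite -[X in enorm X](addrK ((eta * i.+1%:R) *: g)).
  rewrite (le_trans (ler_enormD _ _))// enormN enormZ ger0_norm ?mulr_ge0//.
  have : 2 * Lam * (eta * i.+1%:R) * (eta * Q%:R) * enorm g <=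
      eta * i.+1%:R * enorm g.
    rewrite [X in X <= _](_ : _ =
      2 * Lam * (eta * Q%:R) * (eta * i.+1%:R * enorm g)); last by ring.
    by rewrite ler_piMl// !mulr_ge0 ?enorm_ge0.
  lra.
have [h1 h2] := IHi (ltnW iQ).
set t := local_models eta x S i j k in h1 h2.
have -> : local_models eta x S i.+1 j k - submxrow x j + (eta * i.+1%:R) *: g =
    (t - submxrow x j + (eta * i%:R) *: g) -
    eta *: (stoch_gradient k (with_block x t) S - g).
  rewrite /= -/t -natr1.
  move: t (stoch_gradient _ _ _) (submxrow x j) {IHi h1 h2}.
  by move: g => g t p q; apply/rowP => l; rewrite !mxE; ring.
rewrite (le_trans (ler_enormD _ _))// enormN enormZ ger0_norm//.
have h3 := gL (with_block x t); rewrite enorm_with_block in h3.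
have h4 : enorm (stoch_gradient k (with_block x t) S - g) <=
    2 * Lam * (eta * Q%:R) * enorm g.
  rewrite (le_trans h3)// (le_trans (ler_wpM2l Lam0 h2))//.
  rewrite [X in X <= _](_ : _ = 2 * Lam * (eta * i%:R) * enorm g); last by ring.
  rewrite ler_wpM2r ?enorm_ge0//.
  by rewrite ler_wpM2l ?mulr_ge0// ler_wpM2l// ler_nat ltnW.
have h5 := ler_wpM2l eta0 h4.
by rewrite -natr1; lra.
Qed.

Lemma round_descent (R : realType) (V : tdcd_data R) (Q : nat)
    (eta Lam L : R) (x : model V) (S : {set 'I_(nsamples V)}) :
  (forall j, (0 < nclients V j)%N) ->
  0 <= eta -> 0 <= Lam -> 0 <= L -> 2 * Lam * (eta * Q%:R) <= 1 ->
  (forall j (k : 'I_(nclients V j)) y,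
    enorm (stoch_gradient k y S - stoch_gradient k x S)
      <= Lam * enorm (y - x)) ->
  (forall v, loss V (x + v) <=
     loss V x + dotp (gradient (loss V) x) v + L * enorm v ^+ 2) ->
  loss V (round_step Q eta x S) <= loss V x +
    \sum_j (nclients V j)%:R^-1 * \sum_(k < nclients V j)
      (- (eta * Q%:R) * dotp (partial_gradient j (loss V) x)
                             (stoch_gradient k x S)
       + Lam * (eta * Q%:R) ^+ 2 *
         (enorm (partial_gradient j (loss V) x) ^+ 2
          + enorm (stoch_gradient k x S) ^+ 2)
       + 4 * L * (eta * Q%:R) ^+ 2 * enorm (stoch_gradient k x S) ^+ 2).
Proof.
move=> K0 eta0 Lam0 L0 etaQ gL descent; set A := eta * Q%:R.
have A0 : 0 <= A by rewrite mulr_ge0.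
pose del j k := local_models eta x S Q j k - submxrow x j.
have drift j k : enorm (del j k + A *: stoch_gradient k x S)
      <= 2 * Lam * A ^+ 2 * enorm (stoch_gradient k x S) /\
    enorm (del j k) <= 2 * A * enorm (stoch_gradient k x S).
  have [h1 h2] := local_models_drift eta0 Lam0 etaQ (@gL j k) (leqnn Q).
  by rewrite /del; split; rewrite // expr2 mulrA.
pose v := round_step Q eta x S - x.
(* Each block of the global displacement is the mean of the client displacements, so its squared
   norm is handled by Jensen and its inner product by linearity. *)
have vE j : submxrow v j = (nclients V j)%:R^-1 *: \sum_k del j k.
  rewrite submxrowB mxrowK sumrB scalerBr sumr_const card_ord.
  rewrite -[X in _ - _ *: X]scaler_nat scalerA mulVf ?scale1r//.
  by rewrite pnatr_eq0 -lt0n.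
have -> : round_step Q eta x S = x + v by rewrite addrC subrK.
rewrite (le_trans (descent v))// -addrA lerD2l.
rewrite enorm_sqr !dotp_submxrow mulr_sumr -big_split; apply: ler_sum => j _.
have Kp : 0 <= (nclients V j)%:R^-1 :> R by rewrite invr_ge0.
rewrite -enorm_sqr /= -/(partial_gradient j (loss V) x).
have h := ler_wpM2l L0 (enorm_sqr_mean_le (del j) (K0 j)).
rewrite vE (le_trans (lerD (lexx _) h))// dotpZr mulrCA -mulrDr ler_wpM2l//.
rewrite dotp_sumr mulr_sumr -big_split; apply: ler_sum => k _ /=.
set g := stoch_gradient k x S; set n := partial_gradient j (loss V) x.
have [h1 h2] := drift j k; rewrite -/g in h1 h2.
(* The quadratic term uses the distance bound [2 * A * enorm g], whose square accounts for the
   factor 4. The linear term splits [del j k] into [- A *: g] and the drift error. *)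
rewrite lerD//; last first.
  rewrite [X in _ <= X](_ : _ = L * (2 * A * enorm g) ^+ 2); last by ring.
  by rewrite ler_wpM2l// lerXn2r// nnegrE ?mulr_ge0 ?enorm_ge0.
have -> : del j k = - A *: g + (del j k + A *: g).
  by rewrite addrCA scaleNr addNr addr0.
rewrite dotpDr dotpZr lerD2l.
rewrite (le_trans (dotp_le_enorm _ _))//.
have := ler_wpM2l (enorm_ge0 n) h1.
(* The cross term [2 * enorm n * enorm g] left by Cauchy-Schwarz is at most the sum of the two
   squares. *)
have : 0 <= Lam * A ^+ 2 * (enorm n - enorm g) ^+ 2.
  by rewrite mulr_ge0 ?sqr_ge0// mulr_ge0 ?sqr_ge0.
nra.
Qed.

(** Averages [round_descent] over the batch with [x] frozen and [p] the batch law. Unbiasedness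
    turns the inner product into a squared gradient block, and the second moment of [stoch_gradient]
    is at most twice that square plus [2 * sigma j ^+ 2]; hence [Lam + 2 * (Lam + 4 * L) = 3 * Lam +
    8 * L]. *)
Lemma mean_round_descent (R : realType) (V : tdcd_data R) (Q b : nat)
    (eta Lam L : R) (p : {set 'I_(nsamples V)} -> R)
    (sigma : 'I_(nsilos V) -> R) (x : model V) :
  (forall j, (0 < nclients V j)%N) ->
  0 <= eta -> 0 <= Lam -> 0 <= L -> 2 * Lam * (eta * Q%:R) <= 1 ->
  (forall j (k : 'I_(nclients V j)) y z (S : {set 'I_(nsamples V)}),
    #|S| = b ->
    enorm (stoch_gradient k y S - stoch_gradient k z S)
      <= Lam * enorm (y - z)) ->
  (forall v, loss V (x + v) <=
     loss V x + dotp (gradient (loss V) x) v + L * enorm v ^+ 2) ->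
  (forall S, 0 <= p S) -> \sum_S p S = 1 ->
  (forall S : {set 'I_(nsamples V)}, #|S| != b -> p S = 0) ->
  (forall j (k : 'I_(nclients V j)) i,
    \sum_S p S * stoch_gradient k x S 0 i
    = partial_gradient j (loss V) x 0 i) ->
  (forall j (k : 'I_(nclients V j)),
    \sum_S p S * enorm (stoch_gradient k x S
                        - partial_gradient j (loss V) x) ^+ 2
    <= sigma j ^+ 2) ->
  \sum_S p S * loss V (round_step Q eta x S) <=
  loss V x - eta * Q%:R * enorm (gradient (loss V) x) ^+ 2
  + (eta * Q%:R) ^+ 2 * (3 * Lam + 8 * L) *
    (enorm (gradient (loss V) x) ^+ 2 + \sum_j sigma j ^+ 2).
Proof.
move=> K0 eta0 Lam0 L0 etaQ gL descent p0 p1 pb mean_g var_g.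
set A := eta * Q%:R.
have A0 : 0 <= A by rewrite mulr_ge0.
pose n j := partial_gradient j (loss V) x.
pose T j k S := - A * dotp (n j) (stoch_gradient k x S)
       + Lam * A ^+ 2 * (enorm (n j) ^+ 2 + enorm (stoch_gradient k x S) ^+ 2)
       + 4 * L * A ^+ 2 * enorm (stoch_gradient k x S) ^+ 2.
have step S : p S * loss V (round_step Q eta x S) <= p S * loss V x +
    \sum_j (nclients V j)%:R^-1 * \sum_(k < nclients V j) p S * T j k S.
  (* The Lipschitz bounds concern batches of size [b]; all other batches have weight 0. *)
  have [Sb|/pb ->] := eqVneq #|S| b; last first.
    rewrite !mul0r add0r big1// => j _; rewrite big1 ?mulr0// => k _.
    by rewrite mul0r.
  have := round_descent K0 eta0 Lam0 L0 etaQ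
    (fun j k y => gL j k y x S Sb) descent.
  move=> /(ler_wpM2l (p0 S)) /le_trans; apply.
  rewrite mulrDr lerD2l mulr_sumr; apply: ler_sum => j _.
  by rewrite mulrCA mulr_sumr.
rewrite (le_trans (ler_sum _ (fun S _ => step S)))// big_split/= -mulr_suml p1.
rewrite mul1r -addrA lerD2l exchange_big /=.
have -> : - (A * enorm (gradient (loss V) x) ^+ 2) + A ^+ 2 * (3 * Lam + 8 * L) *
    (enorm (gradient (loss V) x) ^+ 2 + \sum_j sigma j ^+ 2) =
    \sum_j (- (A * enorm (n j) ^+ 2) + A ^+ 2 * (3 * Lam + 8 * L) *
      (enorm (n j) ^+ 2 + sigma j ^+ 2)).
  rewrite big_split/= sumrN -!mulr_sumr big_split/= enorm_sqr dotp_submxrow.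
  by under [X in _ = - (A * X) + _ * (X + _)]eq_bigr do rewrite enorm_sqr.
apply: ler_sum => j _; rewrite -mulr_sumr ler_pdivrMl ?ltr0n//.
(* Writing the right side as a sum of equal terms over the clients lets the inequality be proved
   client by client. *)
have mulr_nclients (y : R) :
    (nclients V j)%:R * y = \sum_(k < nclients V j) y.
  by rewrite sumr_const card_ord mulr_natl.
rewrite exchange_big /= mulr_nclients.
apply: ler_sum => k _.
have dotE : \sum_S p S * dotp (n j) (stoch_gradient k x S) = enorm (n j) ^+ 2.
  rewrite enorm_sqr; under eq_bigr do rewrite mulr_sumr.
  rewrite exchange_big; apply: eq_bigr => i _ /=.
  rewrite -[X in _ = _ * X](mean_g j k) mulr_sumr.
  by apply: eq_bigr => S _; rewrite mulrCA.
have sqrE : \sum_S p S * enorm (stoch_gradient k x S) ^+ 2 <=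
    2 * enorm (n j) ^+ 2 + 2 * sigma j ^+ 2.
  have h S : p S * enorm (stoch_gradient k x S) ^+ 2 <=
      p S * (2 * enorm (n j) ^+ 2)
      + 2 * (p S * enorm (stoch_gradient k x S - n j) ^+ 2).
    rewrite (mulrCA 2 (p S)) -mulrDr ler_wpM2l//.
    have := ler_enormD (n j) (stoch_gradient k x S - n j).
    rewrite addrC subrK; set a := enorm (_ x S); set c := enorm (_ - _).
    have := enorm_ge0 (stoch_gradient k x S); rewrite -/a.
    have : 0 <= (enorm (n j) - c) ^+ 2 by rewrite sqr_ge0.
    have : 0 <= enorm (n j) + c by rewrite addr_ge0 ?enorm_ge0.
    by nra.
  rewrite (le_trans (ler_sum _ (fun S _ => h S)))// big_split/= -mulr_suml p1.
  by rewrite mul1r lerD2l -mulr_sumr ler_wpM2l.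
have -> : \sum_S p S * T j k S = - A * enorm (n j) ^+ 2
    + Lam * A ^+ 2 * enorm (n j) ^+ 2 + (Lam + 4 * L) * A ^+ 2 *
    \sum_S p S * enorm (stoch_gradient k x S) ^+ 2.
  transitivity (\sum_S (- A * (p S * dotp (n j) (stoch_gradient k x S))
      + Lam * A ^+ 2 * enorm (n j) ^+ 2 * p S
      + (Lam + 4 * L) * A ^+ 2 * (p S * enorm (stoch_gradient k x S) ^+ 2))).
    by apply: eq_bigr => S _; rewrite /T; ring.
  by rewrite !big_split/= -!mulr_sumr p1 mulr1 dotE.
have C0 : 0 <= (Lam + 4 * L) * A ^+ 2.
  by rewrite mulr_ge0 ?sqr_ge0// addr_ge0 ?mulr_ge0.
have := ler_wpM2l C0 sqrE.
(* The variance arrives with coefficient [2 * Lam + 8 * L]; this slack raises it to the common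
   [3 * Lam + 8 * L]. *)
have : 0 <= Lam * A ^+ 2 * sigma j ^+ 2.
  by rewrite mulr_ge0 ?sqr_ge0// mulr_ge0 ?sqr_ge0.
lra.
Qed.

(** * Finite random variables *)

Definition law (d : measure_display) (Omega : measurableType d) (R : realType)
    (P : probability Omega R) (T : finType) (X : Omega -> T) (t : T) : R :=
  fine (P (X @^-1` [set t])).

Section FiniteRandomVariable.
Context (d : measure_display) (Omega : measurableType d) (R : realType).
Context (P : probability Omega R).

Lemma finite_random_variable_set1 (T : finType) (X : Omega -> T) :
  (forall t, measurable (X @^-1` [set t])) -> finite_random_variable X.
Proof.
move=> mX A.
have -> : X @^-1` A = \bigcup_(t in A) X @^-1` [set t].
  apply/seteqP; split=> [w Aw|w [t At /= ->//]].
  by exists (X w).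
by apply: fin_bigcup_measurable => // t _; exact: mX.
Qed.

Lemma finite_random_variable_pair (T U : finType) (X : Omega -> T)
    (Y : Omega -> U) : finite_random_variable X -> finite_random_variable Y ->
  finite_random_variable (fun w => (X w, Y w)).
Proof.
move=> mX mY; apply: finite_random_variable_set1 => -[t u].
have -> : (fun w => (X w, Y w)) @^-1` [set (t, u)] =
    X @^-1` [set t] `&` Y @^-1` [set u].
  by apply/seteqP; split=> w /= => [[]|[-> ->]].
by apply: measurableI.
Qed.

Lemma law_ge0 (T : finType) (X : Omega -> T) t : 0 <= law P X t.
Proof. exact: fine_ge0. Qed.

(** [f (X w)] is the sum over [t] of [f t] times the indicator of the event that [X] equals [t], so
    linearity of the integral suffices. *)
Lemma expectation_law (T : finType) (X : Omega -> T) (f : T -> R) :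
  finite_random_variable X ->
  'E_P[fun w => f (X w)]%E = (\sum_t law P X t * f t)%:E.
Proof.
move=> mX; pose D t := X @^-1` [set t].
have mD t : measurable (D t) by exact: mX.
have intD t : P.-integrable setT (fun w => (\1_(D t) w)%:E).
  exact: integrable_indic.
rewrite unlock.
transitivity (\int[P]_w \sum_t ((f t)%:E * (\1_(D t) w)%:E))%E.
  apply: eq_integral => w _; rewrite (bigD1 (X w))//= big1 => [|t tX].
    by rewrite adde0 indicE mem_set// mule1.
  rewrite indicE memNset ?mule0// /D /= => Xt.
  by rewrite Xt eqxx in tX.
rewrite integral_sum// => [|t]; last exact: integrableZl.
rewrite -sumEFin; apply: eq_bigr => t _.
rewrite integralZl// integral_indic// setIT.
by rewrite EFinM muleC /law fineK// fin_num_measure.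
Qed.

Lemma sum_law (T : finType) (X : Omega -> T) :
  finite_random_variable X -> \sum_t law P X t = 1.
Proof.
move=> mX; have := expectation_law (fun=> 1) mX.
rewrite (expectation_cst P 1) => -[->].
by apply: eq_bigr => t _; rewrite mulr1.
Qed.

Lemma law_pair_indep (T U : finType) (X : Omega -> T) (Y : Omega -> U) :
  finite_random_variable X -> finite_random_variable Y ->
  (forall t u, P (X @^-1` [set t] `&` Y @^-1` [set u]) =
     P (X @^-1` [set t]) * P (Y @^-1` [set u]))%E ->
  forall t u, law P (fun w => (X w, Y w)) (t, u) = law P X t * law P Y u.
Proof.
move=> mX mY XY t u; rewrite /law -fineM ?fin_num_measure// -XY.
by congr (fine (P _)); apply/seteqP; split=> w /= => [[]|[-> ->]].
Qed.

End FiniteRandomVariable.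

Section History.
Context (d : measure_display) (Omega : measurableType d) (R : realType).
Context (P : probability Omega R) (T : finType) (X : nat -> Omega -> T).

Definition history n (w : Omega) : {ffun 'I_n -> T} := [ffun i => X (val i) w].

Lemma preimage_history n (s : {ffun 'I_n -> T}) (A : nat -> set T) :
  (forall i : 'I_n, A i = [set s i]) ->
  history n @^-1` [set s] = \bigcap_(i in [set` iota 0 n]) X i @^-1` A i.
Proof.
move=> As; apply/seteqP; split=> w /=.
  move=> hs i /=; rewrite mem_iota /= add0n => ni.
  by rewrite (As (Ordinal ni)) /= -hs ffunE.
move=> h; apply/ffunP => i; rewrite ffunE.
have := h (val i); rewrite /= As; apply.
by rewrite mem_iota /= add0n.
Qed.

Lemma finite_random_variable_history n :
  (forall r, finite_random_variable (X r)) ->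
  finite_random_variable (@history n).
Proof.
move=> mX; apply: finite_random_variable_set1 => s.
pose A i := if insub i is Some i' then [set s i'] else set0.
rewrite (@preimage_history n s A) => [|i]; last by rewrite /A valK.
by apply: fin_bigcap_measurable => // i _; exact: mX.
Qed.

(** A value of the history is an intersection of events on the first [n] batches, so the product
    formula on [iota 0 n] and on [iota 0 n.+1] gives the claim by division of the products at the
    last factor. *)
Lemma history_indep n (s : {ffun 'I_n -> T}) t :
  mutually_independent P X ->
  (P (history n @^-1` [set s] `&` X n @^-1` [set t]) =
   P (history n @^-1` [set s]) * P (X n @^-1` [set t]))%E.
Proof.
(* One family covers both events: the values of [s] below [n], and [t] from [n] on, of which only
   index [n] is read. *)
move=> indep; pose A i := if insub i is Some i' then [set s i'] else [set t].
rewrite (@preimage_history n s A) => [|i]; last by rewrite /A valK.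
have An : A n = [set t] by rewrite /A insubF// ltnn.
have -> : \bigcap_(i in [set` iota 0 n]) X i @^-1` A i `&` X n @^-1` [set t] =
    \bigcap_(i in [set` iota 0 n.+1]) X i @^-1` A i.
  apply/seteqP; split=> w /=.
    move=> [h ht] i ni; have {ni} : i \in iota 0 n.+1 := ni.
    rewrite mem_iota /= add0n ltnS leq_eqVlt => /predU1P[->|ni].
      by rewrite An.
    by apply: h; rewrite /= mem_iota.
  move=> h.
  have {}h i : (i < n.+1)%N -> A i (X i w).
    move=> ni; have {}ni : i \in iota 0 n.+1 by rewrite mem_iota.
    exact: h ni.
  split=> [i /=|]; last by have := h n (ltnSn n); rewrite An.
  by rewrite mem_iota add0n => /= ni; apply: h; rewrite ltnW.
rewrite !indep ?iota_uniq// -addn1 iotaD big_cat /= add0n.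
by rewrite big_seq1 An.
Qed.

(** Conditioning on the past as an iterated finite sum: the inner sum averages over the next batch
    with the history held fixed. *)
Lemma expectation_history_next n (f : {ffun 'I_n -> T} -> T -> R) :
  (forall r, finite_random_variable (X r)) -> mutually_independent P X ->
  'E_P[fun w => f (history n w) (X n w)]%E =
  (\sum_s law P (history n) s * \sum_t law P (X n) t * f s t)%:E.
Proof.
move=> mX indep; have mH : finite_random_variable (@history n).
  exact: finite_random_variable_history.
rewrite (@expectation_law _ _ _ P _ (fun w => (history n w, X n w))
  (fun st => f st.1 st.2)); last exact: finite_random_variable_pair.
congr (_%:E); transitivity (\sum_s \sum_t
    law P (fun w => (history n w, X n w)) (s, t) * f s t).
  by rewrite pair_bigA; apply: eq_bigr => -[].
apply: eq_bigr => s _; rewrite mulr_sumr; apply: eq_bigr => t _.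
by rewrite law_pair_indep// ?mulrA// => *; exact: history_indep.
Qed.

End History.

(** * The convergence rate *)

(* The default value set0 at i >= n is never read by the first n rounds. *)
Definition history_seq (m n : nat) (s : {ffun 'I_n -> {set 'I_m}}) (i : nat) :
    {set 'I_m} :=
  if insub i is Some i' then s i' else finset.set0.

Lemma round_model_history (R : realType) (V : tdcd_data R) (Q : nat) (eta : R)
    (x0 : model V) (d : measure_display) (Omega : measurableType d)
    (zeta : nat -> Omega -> {set 'I_(nsamples V)}) r w :
  round_model Q eta x0 (zeta^~ w) r =
  round_model Q eta x0 (history_seq (@history _ _ _ zeta r w)) r.
Proof.
apply: eq_round_model => i ir.
by rewrite /history_seq insubT ffunE.
Qed.

(** Here [e] stands for the expected loss and [g] for the expected squared gradient norm. Since
    [A * B <= 2^-1], the second-order term in [g r] consumes at most half of the decrease. *)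
Lemma telescoped_descent (R : realType) (A B s Linf : R) (e g : nat -> R) :
  0 <= A -> A * B <= 2^-1 ->
  (forall r, Linf <= e r) -> (forall r, 0 <= g r) ->
  (forall r, e r.+1 <= e r - A * g r + A ^+ 2 * B * (g r + s)) ->
  forall n, A / 2 * \sum_(0 <= r < n) g r
    <= e 0%N - Linf + n%:R * (A ^+ 2 * B * s).
Proof.
move=> A0 AB Le g0 step n.
(* The induction keeps [e n], which telescopes; the lower bound [Linf] enters only at the end. *)
apply: (@le_trans _ _ (e 0%N - e n + n%:R * (A ^+ 2 * B * s))); last first.
  by rewrite lerD2r lerD2l lerN2.
elim: n => [|n IHn]; first by rewrite big_geq// mulr0 subrr mul0r addr0.
rewrite big_nat_recr//= mulrDr -(natr1 n).
have h : A ^+ 2 * B * g n <= A / 2 * g n.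
  by rewrite expr2 -mulrA -mulrA -[leRHS]mulrA ler_wpM2l// mulrA ler_wpM2r.
by have := step n; lra.
Qed.

Theorem mainTheorem2 (R : realType) (V : tdcd_data R)
  (Mgt0 : (0 < nsamples V)%N)
  (Ngt0 : (0 < nsilos V)%N)
  (Kgt0 : forall j, (0 < nclients V j)%N)
  (embed_diff : forall j (x : feature V j) (theta_j : 'rV[R]_(bdim V j)),
     differentiable (fun u : 'rV[R]_(bdim V j) => embed V j u x) theta_j)
  (ell_diff : forall (y : label V) (z : 'rV[R]_(edim V)),
     differentiable (fun u : 'rV[R]_(edim V) => ell V u y) z)
  (b : nat) (bgt0 : (0 < b)%N) (bleM : (b <= nsamples V)%N)
  (d : measure_display) (Omega : measurableType d) (P : probability Omega R)
  (zeta : nat -> Omega -> {set 'I_(nsamples V)})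
  (zeta_rv : forall r, finite_random_variable (zeta r))
  (zeta_indep : mutually_independent P zeta)
  (zeta_unif : forall r, uniform_batch P b (zeta r))
  (L : R) (Lgt0 : 0 < L)
  (Lkj : forall j, 'I_(nclients V j) -> R)
  (Lkjgt0 : forall j (k : 'I_(nclients V j)), 0 < Lkj j k)
  (loss_smooth : forall theta1 theta2 : model V,
     enorm (gradient (loss V) theta1 - gradient (loss V) theta2)
     <= L * enorm (theta1 - theta2))
  (stoch_smooth : forall j (k : 'I_(nclients V j)) (theta1 theta2 : model V)
     (S : {set 'I_(nsamples V)}), #|S| = b ->
     enorm (stoch_gradient k theta1 S - stoch_gradient k theta2 S)
     <= Lkj j k * enorm (theta1 - theta2))
  (Linf : R)
  (loss_bounded : forall theta : model V, Linf <= loss V theta)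
  (sigma : 'I_(nsilos V) -> R)
  (stoch_unbiased : forall r j (k : 'I_(nclients V j)) (theta : model V) i,
     ('E_P[fun w => (stoch_gradient k theta (zeta r w) 0 i)%R]
      = (partial_gradient j (loss V) theta 0 i)%:E)%E)
  (stoch_variance : forall r j (k : 'I_(nclients V j)) (theta : model V),
     ('E_P[fun w => (enorm (stoch_gradient k theta (zeta r w)
                           - partial_gradient j (loss V) theta) ^+ 2)%R]
      <= (sigma j ^+ 2)%:E)%E)
  (Q : nat) (Qgt0 : (0 < Q)%N) (theta0 : model V)
  (c : R) (cgt0 : 0 < c) :
  exists (C : R) (R0 : nat), forall nrounds : nat, (R0 <= nrounds)%N ->
    let eta := c / (Q%:R * Num.sqrt nrounds%:R) in
    ((nrounds%:R^-1)%:E *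
       \sum_(0 <= r < nrounds)
         'E_P[fun w => (enorm (gradient (loss V)
                (global_model Q eta theta0 (zeta^~ w) (r * Q)%N)) ^+ 2)%R]
     <= (C / Num.sqrt nrounds%:R)%:E)%E.
Proof.
(* A single Lipschitz constant for all clients: the sum of positive constants dominates each of
   them. *)
pose Lam := \sum_j \sum_k @Lkj j k.
have Lkj_le j k : @Lkj j k <= Lam.
  rewrite /Lam (bigD1 j)//= (bigD1 k)//= -addrA lerDl addr_ge0// ?sumr_ge0//.
    by move=> i _; rewrite ltW.
  by move=> i _; rewrite sumr_ge0// => l _; rewrite ltW.
have Lam0 : 0 <= Lam.
  by apply: sumr_ge0 => j _; apply: sumr_ge0 => k _; rewrite ltW.
pose B := 3 * Lam + 8 * L.
have LamB : Lam <= B by rewrite /B; have := Lgt0; have := Lam0; lra.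
have B0 : 0 <= B by exact: le_trans LamB.
pose s := \sum_j sigma j ^+ 2.
pose Delta := loss V theta0 - Linf.
pose C := 2 * (Delta + c ^+ 2 * B * s) / c.
(* The threshold forces [2 * c * B <= q], that is [eta * Q%:R * B <= 2^-1]; the successor also makes
   [n] positive. *)
exists C, (Num.bound ((2 * c * B) ^+ 2)).+1 => n nR.
cbv zeta; set eta := c / _.
have n0 : 0 < n%:R :> R by rewrite ltr0n; apply: leq_trans nR.
pose q := Num.sqrt (n%:R : R).
have q0 : 0 < q by rewrite sqrtr_gt0.
have qq : q ^+ 2 = n%:R by rewrite sqr_sqrtr// ltW.
have Q0 : 0 < Q%:R :> R by rewrite ltr0n.
have eta0 : 0 <= eta by rewrite /eta divr_ge0// ?mulr_ge0// ltW.
have AE : eta * Q%:R = c / q.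
  by rewrite /eta -/q; field; rewrite !gt_eqF.
have A0 : 0 <= eta * Q%:R by rewrite mulr_ge0.
have AB : eta * Q%:R * B <= 2^-1.
  have cBq : 2 * c * B <= q.
    rewrite -(@ler_pXn2r _ 2) ?nnegrE ?(ltW q0) ?mulr_ge0 ?(ltW cgt0)// qq.
    have := archi_boundP (sqr_ge0 (2 * c * B)) => /ltW /le_trans; apply.
    by rewrite ler_nat ltnW.
  by rewrite AE mulrAC ler_pdivrMr// -ler_pdivrMl//; lra.
have AL : 2 * Lam * (eta * Q%:R) <= 1.
  by have := ler_wpM2l A0 LamB; lra.
have mH r : finite_random_variable (@history _ _ _ zeta r).
  exact: finite_random_variable_history.
pose x r (h : {ffun 'I_r -> {set 'I_(nsamples V)}}) :=
  round_model Q eta theta0 (history_seq h) r.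
pose mean r (F : model V -> R) :=
  \sum_h law P (@history _ _ _ zeta r) h * F (x r h).
have meanE r F : 'E_P[fun w => F (round_model Q eta theta0 (zeta^~ w) r)]%E =
    (mean r F)%:E.
  rewrite -(expectation_law P (fun h => F (x r h)))//; congr expectation.
  by apply/funext => w; rewrite round_model_history.
have mean_ge0 r F : (forall y, 0 <= F y) -> 0 <= mean r F.
  by move=> F0; apply: sumr_ge0 => h _; rewrite mulr_ge0// law_ge0.
pose g r := mean r (fun y => enorm (gradient (loss V) y) ^+ 2).
have lawE r S : law P (zeta r) S =
    if #|S| == b then 'C(nsamples V, b)%:R^-1 else 0.
  by rewrite /law zeta_unif.
have descent := smooth_descent
  (differentiable_loss embed_diff ell_diff) loss_smooth.
(* Conditioning on the history freezes the start of round [r] at [x r h], where the moment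
   assumptions, stated for fixed models, apply. *)
have step r : mean r.+1 (loss V) <= mean r (loss V) - eta * Q%:R * g r +
    (eta * Q%:R) ^+ 2 * B * (g r + s).
  have -> : mean r.+1 (loss V) = \sum_h law P (@history _ _ _ zeta r) h *
      \sum_S law P (zeta r) S * loss V (round_step Q eta (x r h) S).
    apply: EFin_inj; rewrite -meanE -expectation_history_next//.
    congr expectation; apply/funext => w /=.
    by rewrite round_model_history.
  have -> : mean r (loss V) - eta * Q%:R * g r +
      (eta * Q%:R) ^+ 2 * B * (g r + s) =
    \sum_h law P (@history _ _ _ zeta r) h * (loss V (x r h)
      - eta * Q%:R * enorm (gradient (loss V) (x r h)) ^+ 2
      + (eta * Q%:R) ^+ 2 * B * (enorm (gradient (loss V) (x r h)) ^+ 2 + s)).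
    (* The constant [s] is spread over the histories through the total mass 1, to compare the two
       sides history by history. *)
    rewrite -[s in LHS]mul1r -(sum_law P (mH r)) mulr_suml /g /mean.
    rewrite -big_split !mulr_sumr -sumrB -big_split.
    by apply: eq_bigr => h _ /=; ring.
  apply: ler_sum => h _; rewrite ler_wpM2l ?law_ge0//.
  apply: (@mean_round_descent _ _ _ b) => //.
  - exact: ltW.
  - move=> j k y z S Sb; rewrite (le_trans (stoch_smooth _ _ _ _ _ Sb))//.
    by rewrite ler_wpM2r ?enorm_ge0.
  - by move=> S; exact: law_ge0.
  - exact: sum_law.
  - by move=> S /negPf Sb; rewrite lawE Sb.
  - move=> j k i; apply: EFin_inj; rewrite -(stoch_unbiased r j k).
    by rewrite -(expectation_law P (fun S => stoch_gradient k (x r h) S 0 i)).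
  - move=> j k; have := stoch_variance r j k (x r h).
    by rewrite (expectation_law P (fun S => enorm (stoch_gradient k (x r h) S
      - partial_gradient j (loss V) (x r h)) ^+ 2))// lee_fin.
have main : eta * Q%:R / 2 * \sum_(0 <= r < n) g r <=
    Delta + n%:R * ((eta * Q%:R) ^+ 2 * B * s).
  have -> : Delta = mean 0%N (loss V) - Linf.
    by rewrite /mean /x /= -mulr_suml sum_law// mul1r.
  apply: (telescoped_descent (e := fun r => mean r (loss V))) => //.
  - move=> r; rewrite -[Linf]mul1r -(sum_law P (mH r)) mulr_suml.
    by apply: ler_sum => h _; rewrite ler_wpM2l ?law_ge0.
  - by move=> r; apply: mean_ge0 => y; rewrite sqr_ge0.
rewrite [X in (_ * X)%E](eq_bigr (fun r => (g r)%:E)) => [|r _]; last first.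
  rewrite /g -meanE; congr expectation; apply/funext => w.
  by rewrite global_model_round.
rewrite sumEFin -EFinM lee_fin -/q ler_pdivrMl//.
move: main; rewrite AE -qq.
(* With step size [c / q], the second-order errors of all [n] rounds add up to a quantity
   independent of [n]; the factor [2 * q / c] then yields [C]. *)
have -> : q ^+ 2 * ((c / q) ^+ 2 * B * s) = c ^+ 2 * B * s.
  by field; rewrite gt_eqF.
have -> : q ^+ 2 * (C / q) = 2 * q / c * (Delta + c ^+ 2 * B * s).
  by rewrite /C; field; rewrite !gt_eqF.
set G := \sum_(0 <= r < n) _ => main.
rewrite [leLHS](_ : _ = 2 * q / c * (c / q / 2 * G)); last first.
  by field; rewrite !gt_eqF.
by rewrite ler_wpM2l// divr_ge0 ?mulr_ge0 ?ltW.
Qed.
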